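(* Let $A_1=P_1J_1P_1^{-1}$ with $J_1=\begin{pmatrix}-n_1&1\\0&-n_1\end{pmatrix}$, $n_1>0$, and $A_2=P_2J_2P_2^{-1}$ with $J_2=\begin{pmatrix}n_2&1\\0&n_2\end{pmatrix}$, $n_2\ge0$; here $P_1,P_2$ are real invertible $2\times 2$ matrices with $|\det P_1|=|\det P_2|=1$, and $M=P_2^{-1}P_1=\begin{pmatrix}a&b\\c&d\end{pmatrix}$. Let $\eta>0$ be given. (i) If $c=0$, let $\tau_{2,1}(\eta)$ be the unique positive solution $t$ of $n_2\eta+\ln\theta(\eta)=n_1t-\sinh^{-1}\left(\frac{a^2}{2}t\right)$. (ii) If $c\neq0$, let $\tau_{2,1}(\eta)$ be the unique positive solution $t$ of $n_2\eta+\ln\theta(\eta)=n_1t-\sinh^{-1}\left(\frac{c^2}{2}t\right)$. Then the switched system $\dot x(t)=A_{\sigma(t)}x(t)$ is stable for all $\sigma\in\mathcal S[\tau_{2,1}(\eta),\eta]$ and asymptotically stable for all $\sigma\in\mathcal S'[\tau_{2,1}(\eta),\eta]$.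
   Context: $\theta(t)=\left\|\begin{pmatrix}1&t\\0&1\end{pmatrix}\right\|=\sqrt{1+\frac{t^2}{2}+t\sqrt{1+\frac{t^2}{4}}}$ (spectral norm). Planar switched system: $\dot x(t)=A_{\sigma(t)}x(t)$, $x(t)\in\mathbb R^2$ continuous in $t\ge0$, with $A_1,A_2$ real $2\times2$ matrices. A switching signal $\sigma:[0,\infty)\to\{1,2\}$ is right-continuous and piecewise constant with infinitely many discontinuities $0<d_1<d_2<\cdots$, $d_k\to\infty$; set $d_0=0$. For a signal with $\sigma(0)=1$ put $t_k=d_{2k-1}-d_{2k-2}$ (times spent in $A_1$) and $s_k=d_{2k}-d_{2k-1}$ (times spent in $A_2$), $k\ge1$. For $\tau,\eta>0$, $\mathcal S[\tau,\eta]$ is the set of signals with $\sigma(0)=1$, $t_k\ge\tau$ and $s_k\le\eta$ for all $k\in\mathbb N$; $\mathcal S'[\tau,\eta]$ is the set of $\sigma\in\mathcal S[\tau,\eta]$ for which the sequence $(t_k,s_k)_{k\ge1}$ does not converge to $(\tau,\eta)$. For a given signal $\sigma$, the system is stable if for every $\varepsilon'>0$ there is $\delta>0$ such that $\|x(0)\|<\delta$ implies $\|x(t)\|<\varepsilon'$ for all $t>0$; it is asymptotically stable if it is stable and $\|x(t)\|\to0$ as $t\to\infty$ for every $x(0)\in\mathbb R^2$. Vector norms are Euclidean. *)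

(* Defs.v *)
From HB Require Import structures.
From mathcomp Require Import all_boot all_order all_algebra.
From mathcomp Require Import all_classical all_reals all_analysis.
From mathcomp Require Import ring lra.

Set Implicit Arguments.
Unset Strict Implicit.
Unset Printing Implicit Defensive.
Import Order.TTheory GRing.Theory Num.Theory.
Import numFieldNormedType.Exports.
Local Open Scope classical_set_scope.
Local Open Scope ring_scope.

Definition mx22 (R : realType) (a b c d : R) : 'M[R]_2 :=
  \matrix_(i, j) if i == 0 then (if j == 0 then a else b)
                 else (if j == 0 then c else d).

Definition jordan2 (R : realType) (l : R) : 'M[R]_2 := mx22 l 1 0 l.

(* The library norm `|x| on 'cV[R]_2 is the max norm. *)
Definition enorm (R : realType) (x : 'cV[R]_2) : R :=
  Num.sqrt (\sum_(i < 2) x i 0 ^+ 2).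

Definition specnorm (R : realType) (A : 'M[R]_2) : R :=
  sup [set enorm (A *m x) | x in [set x : 'cV[R]_2 | enorm x <= 1]].

Definition theta (R : realType) (t : R) : R := specnorm (mx22 1 t 0 1).

Definition sinh (R : realType) (x : R) : R := (expR x - expR (- x)) / 2.

Definition arsinh (R : realType) (x : R) : R := ln (x + Num.sqrt (x ^+ 2 + 1)).

Lemma arsinh_arg_gt0 (R : realType) (x : R) : 0 < x + Num.sqrt (x ^+ 2 + 1).
Proof.
have h : `|x| < Num.sqrt (x ^+ 2 + 1).
  by rewrite -sqrtr_sqr ltr_sqrt ?ltrDl// ltr_wpDl// sqr_ge0.
by have := ler_normr (- x) (- x); rewrite lexx /= normrN => hx; lra.
Qed.

Lemma arsinhK (R : realType) : cancel (@arsinh R) (@sinh R).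
Proof.
move=> x; rewrite /sinh /arsinh expRN lnK ?posrE ?arsinh_arg_gt0//.
have h0 := arsinh_arg_gt0 x.
have hs : Num.sqrt (x ^+ 2 + 1) ^+ 2 = x ^+ 2 + 1.
  by rewrite sqr_sqrtr// addr_ge0// sqr_ge0.
move: h0 hs; set s := Num.sqrt _ => h0 hs.
have -> : (x + s)^-1 = s - x.
  apply: (mulIf (lt0r_neq0 h0)); rewrite mulVf ?lt0r_neq0//.
  have -> : (s - x) * (x + s) = s ^+ 2 - x ^+ 2 by ring.
  by rewrite hs; ring.
by field.
Qed.

Lemma sinhK (R : realType) : cancel (@sinh R) (@arsinh R).
Proof.
move=> x; rewrite /arsinh.
have e : expR x * expR (- x) = 1 by rewrite -expRD subrr expR0.
have -> : sinh x ^+ 2 + 1 = ((expR x + expR (- x)) / 2) ^+ 2.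
  rewrite /sinh; apply/eqP; rewrite -subr_eq0; apply/eqP.
  transitivity (1 - expR x * expR (- x)); first by field.
  by rewrite e subrr.
rewrite sqrtr_sqr ger0_norm ?divr_ge0 ?addr_ge0 ?expR_ge0//.
rewrite /sinh (_ : _ + _ = expR x) ?expRK//.
by field.
Qed.

Inductive mode := mode1 | mode2.

(* Only the values of the signal on [0, +oo) are constrained or used.
   [disc k] for k >= 1 are the discontinuities, and [disc 0] = 0; they are
   determined by the signal. *)
Record switching_signal (R : realType) := SwitchingSignal {
  mode_at :> R -> mode;
  disc : nat -> R;
  disc0 : disc 0%N = 0;
  disc_lt : forall k, disc k < disc k.+1;
  disc_cvgy : disc @ \oo --> +oo;
  mode_const : forall k t,
    disc k <= t < disc k.+1 -> mode_at t = mode_at (disc k);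
  mode_jump : forall k, mode_at (disc k.+1) <> mode_at (disc k)
}.

(* Indices are shifted by one: [time1 s k] and [time2 s k] are the usual
   t_(k+1) and s_(k+1). *)
Definition time1 (R : realType) (s : switching_signal R) (k : nat) : R :=
  disc s k.*2.+1 - disc s k.*2.

Definition time2 (R : realType) (s : switching_signal R) (k : nat) : R :=
  disc s k.*2.+2 - disc s k.*2.+1.

Definition dwell_flee (R : realType) (tau eta : R) : set (switching_signal R) :=
  [set s : switching_signal R | s 0 = mode1 /\ forall k, tau <= time1 s k /\ time2 s k <= eta].

Definition dwell_flee' (R : realType) (tau eta : R) : set (switching_signal R) :=
  [set s : switching_signal R | dwell_flee tau eta s /\
    ~ ((time1 s k, time2 s k) @[k --> \oo] --> (tau, eta))].

Section system.
Variables (R : realType) (A1 A2 : 'M[R]_2) (s : switching_signal R).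

Definition mode_mx (m : mode) : 'M[R]_2 :=
  match m with mode1 => A1 | mode2 => A2 end.

Definition trajectory (x : R -> 'cV[R]_2) : Prop :=
  {within `[0, +oo[, continuous x} /\
  forall k t, disc s k < t < disc s k.+1 ->
    is_derive t 1 x (mode_mx (s t) *m x t).

Definition stable : Prop :=
  forall eps, 0 < eps -> exists2 delta, 0 < delta &
    forall x, trajectory x -> enorm (x 0) < delta ->
      forall t, 0 < t -> enorm (x t) < eps.

Definition asymptotically_stable : Prop :=
  stable /\ forall x, trajectory x -> enorm (x t) @[t --> +oo] --> 0.

End system.

Definition tau_equation (R : realType) (n1 n2 eta q t : R) : Prop :=
  n2 * eta + ln (theta eta) = n1 * t - arsinh (q ^+ 2 / 2 * t).

Definition is_tau21 (R : realType) (n1 n2 a c eta t : R) : Prop :=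
  [/\ 0 < t,
      c = 0 -> tau_equation n1 n2 eta a t &
      c <> 0 -> tau_equation n1 n2 eta c t].

(* Main.v *)
Require Import Defs.
From HB Require Import structures.
From mathcomp Require Import all_boot all_order all_algebra.
From mathcomp Require Import all_classical all_reals all_analysis.
From mathcomp Require Import ring lra.

(** Why the theorem holds.

    Measure the state by the Euclidean norm V of its coordinates y = Q x, where
    Q is chosen so that both modes are as simple as possible at once. Starting
    from the Jordan basis P2 of A2, one may still multiply P2 on the right by
    any upper unitriangular U, since U commutes with the Jordan block of A2.
    When c <> 0, the choice of U with corner a / c makes the eigenvector of A1
    the second coordinate axis; when c = 0 that eigenvector is already the first
    axis and U = 1 will do. In both cases A2 becomes its Jordan block, and A1
    becomes -n1 plus a single off-diagonal entry k, above or below the diagonal.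
    As the determinant of P2^-1 P1 is 1 up to sign, |k| = q ^ 2, with q = a if
    c = 0 and q = c otherwise ([common_coordinates]).

    Each mode then acts, during a time t, as a scalar exponential times a shear
    with parameter k t (k = 1 in the second mode). The spectral norm of a shear
    with parameter t >= 0 is theta t = exp (arsinh (t / 2)), the root r > 0 of
    r - 1 / r = t ([theta_shear_gain]). So the first mode multiplies V by at
    most exp (- g t), where g t = n1 t - arsinh (q ^ 2 t / 2), and the second
    one by at most exp (h s), where h s = n2 s + arsinh (s / 2)
    ([flow_growth]); the equation that defines tau is h eta = g tau.

    The function h is increasing. The function g need not be monotone near 0,
    but arsinh is concave with value 0 at 0, so that g t >= (t / tau) g tau for
    t >= tau ([decay_scale]); since g tau = h eta > 0, all later values of g
    exceed g tau. This gives the uniqueness of tau (its existence is the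
    intermediate value theorem), and it shows that V does not increase over a
    period with t_k >= tau and s_k <= eta. Inside a period V exceeds its value
    at the start of the period by a bounded factor only, whence stability. If
    (t_k, s_k) does not converge to (tau, eta), then infinitely often
    t_k >= tau + e or s_k <= eta - e for a fixed e > 0; each such period
    contracts V by a fixed factor r < 1, so that V tends to 0. *)

Set Implicit Arguments.
Unset Strict Implicit.
Unset Printing Implicit Defensive.
Import Order.TTheory GRing.Theory Num.Theory.
Import numFieldNormedType.Exports.
Local Open Scope classical_set_scope.
Local Open Scope ring_scope.

(** * The inverse hyperbolic sine and the norm of a shear *)

Section arsinh_theory.
Variable R : realType.
Implicit Types x y t v : R.

Lemma sinh_lt : {homo @sinh R : x y / x < y}.
Proof.
move=> x y xy; rewrite /sinh ltr_pM2r ?invr_gt0// ltrB// ltr_expR//.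
by rewrite ltrN2.
Qed.

Lemma arsinh_lt : {mono @arsinh R : x y / x < y}.
Proof.
have sinhW := ltW_homo sinh_lt.
move=> x y; apply/idP/idP => [|xy]; first by move/sinh_lt; rewrite !arsinhK.
rewrite ltNge; apply/negP => /sinhW; rewrite !arsinhK leNgt.
by rewrite xy.
Qed.

Lemma arsinh_le : {mono @arsinh R : x y / x <= y}.
Proof. by move=> x y; rewrite !leNgt arsinh_lt. Qed.

Lemma arsinh0 : arsinh (0 : R) = 0.
Proof. by rewrite /arsinh add0r expr0n/= add0r sqrtr1 ln1. Qed.

Lemma arsinh_ge0 x : 0 <= x -> 0 <= arsinh x.
Proof. by rewrite -{2}arsinh0 arsinh_le. Qed.

Lemma continuous_arsinh : continuous (@arsinh R).
Proof.
move=> x; rewrite /arsinh; apply: continuous_comp; last first.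
  exact/continuous_ln/arsinh_arg_gt0.
apply: cvgD; first exact: cvg_id.
apply: continuous_comp; last exact: sqrt_continuous.
apply: cvgD; last exact: cvg_cst.
exact: exprn_continuous.
Qed.

(** Monotonicity of the hyperbolic cosine on the nonnegative half-line; it gives
    the sign of the derivative in [sinh_scale]. *)
Lemma expR_addN_le x y : 0 <= x -> x <= y ->
  expR x + expR (- x) <= expR y + expR (- y).
Proof.
move=> x0 xy; rewrite -subr_ge0 !expRN.
have -> : expR y + (expR y)^-1 - (expR x + (expR x)^-1) =
    (expR y - expR x) * (1 - (expR x)^-1 * (expR y)^-1).
  by field; rewrite !gt_eqF ?expR_gt0.
rewrite mulr_ge0 ?subr_ge0 ?ler_expR// -!expRN -expRD -expR0 ler_expR.
by lra.
Qed.

Lemma is_derive_sinh_scale (l v : R) :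
  is_derive v 1 (fun u => sinh (l * u)) (l * ((expR (l * v) + expR (- (l * v))) / 2)).
Proof.
rewrite /sinh.
apply: is_derive_eq.
by rewrite ?(scaler0, addr0, add0r) /GRing.scale/=; field.
Qed.

(** The hyperbolic sine is convex on the nonnegative half-line and vanishes at 0:
    the difference of the two sides vanishes at v = 0 and has derivative
    l (cosh (l v) - cosh v) >= 0. *)
Lemma sinh_scale (l v : R) : 1 <= l -> 0 <= v -> l * sinh v <= sinh (l * v).
Proof.
move=> l1 v0; rewrite -subr_ge0.
(* The factor 1 lets one derivative rule serve for both terms. *)
pose f u : R := sinh (l * u) - l * sinh (1 * u).
have df (u : R) : is_derive u 1 f (l * ((expR (l * u) + expR (- (l * u))) / 2)
    - l * (1 * ((expR (1 * u) + expR (- (1 * u))) / 2))).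
  apply: is_deriveB; first exact: is_derive_sinh_scale.
  by apply: is_deriveZ; exact: is_derive_sinh_scale.
have f0 : f 0 = 0 by rewrite /f !mulr0 /sinh oppr0 subrr mul0r mulr0 subrr.
suff : f 0 <= f v by rewrite f0 /f mul1r.
apply: (@ger0_derive1_ndecry _ f 0) => //.
- move=> u; rewrite in_itv/= andbT => u0; rewrite derive1E derive_val.
  rewrite -mulrBr mulr_ge0 ?(le_trans _ l1)// mul1r -mulrBl divr_ge0// !mul1r.
  rewrite subr_ge0; apply: expR_addN_le; first exact: ltW.
  by rewrite ler_peMl// ltW.
- apply: continuous_subspaceT => u; apply: differentiable_continuous.
  by apply/derivable1_diffP; have [] := df u.
Qed.

(** The form in which the concavity of arsinh enters the comparison of dwell
    times. *)
Lemma arsinh_scale (l x : R) : 1 <= l -> 0 <= x -> arsinh (l * x) <= l * arsinh x.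
Proof.
move=> l1 x0; rewrite -[leRHS](@sinhK R) arsinh_le.
by rewrite -{1}(arsinhK x) sinh_scale ?arsinh_ge0.
Qed.

(** The spectral norm of the shear with parameter t >= 0, see
    [theta_shear_gain]; it equals t / 2 + sqrt (1 + t ^ 2 / 4). *)
Definition shear_gain t : R := expR (arsinh (t / 2)).

Lemma shear_gain_gt0 t : 0 < shear_gain t.
Proof. exact: expR_gt0. Qed.

Lemma shear_gainBV t : shear_gain t - (shear_gain t)^-1 = t.
Proof.
have := arsinhK (t / 2); rewrite {1}/sinh expRN -/(shear_gain t).
by move/(congr1 (fun z => z * 2)); rewrite !divfK.
Qed.

(** With r the gain, t = r - 1 / r, and the right-hand side minus the left-hand
    side is (t / r) (r y1 - y2) ^ 2. *)
Lemma shear_sqnorm t (y1 y2 : R) : 0 <= t ->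
  (y1 + t * y2) ^+ 2 + y2 ^+ 2 <= shear_gain t ^+ 2 * (y1 ^+ 2 + y2 ^+ 2).
Proof.
move=> t0; have r0 := shear_gain_gt0 t; have := shear_gainBV t.
move: (shear_gain t) r0 => r r0 rt; rewrite -subr_ge0.
have -> : r ^+ 2 * (y1 ^+ 2 + y2 ^+ 2) - ((y1 + t * y2) ^+ 2 + y2 ^+ 2) =
  (t / r) * (r * y1 - y2) ^+ 2.
  by rewrite -rt; field; rewrite gt_eqF.
by rewrite mulr_ge0 ?sqr_ge0// divr_ge0// ltW.
Qed.

Lemma shear_sqnorm_abs t (y1 y2 : R) :
  (y1 + t * y2) ^+ 2 + y2 ^+ 2 <= shear_gain `|t| ^+ 2 * (y1 ^+ 2 + y2 ^+ 2).
Proof.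
have [t0|t0] := ger0P t; first exact: shear_sqnorm.
have nt0 : 0 <= - t by rewrite oppr_ge0 ltW.
by have := shear_sqnorm y1 (- y2) nt0; rewrite mulrNN sqrrN.
Qed.

Lemma sum_ord2 (F : 'I_2 -> R) : \sum_(i < 2) F i = F 0 + F 1.
Proof. by rewrite !big_ord_recl big_ord0 addr0; congr (_ + F _); exact/val_inj. Qed.

Lemma enorm_ge0 (x : 'cV[R]_2) : 0 <= enorm x.
Proof. exact: sqrtr_ge0. Qed.

Lemma enorm_sqr (x : 'cV[R]_2) : enorm x ^+ 2 = x 0 0 ^+ 2 + x 1 0 ^+ 2.
Proof. by rewrite sqr_sqrtr sum_ord2// addr_ge0 ?sqr_ge0. Qed.

Lemma enorm_le (x : 'cV[R]_2) (C : R) : 0 <= C ->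
  (enorm x <= C) = (x 0 0 ^+ 2 + x 1 0 ^+ 2 <= C ^+ 2).
Proof. by move=> C0; rewrite -enorm_sqr ler_sqr ?nnegrE ?enorm_ge0. Qed.

Lemma mulmx_ord2 (A : 'M[R]_2) (x : 'cV[R]_2) i :
  (A *m x) i 0 = A i 0 * x 0 0 + A i 1 * x 1 0.
Proof. by rewrite mxE sum_ord2. Qed.

(** The upper bound is [shear_sqnorm]; the vectors proportional to (1, r) make
    the square in its proof vanish, so they attain the bound. *)
Lemma theta_shear_gain t : 0 <= t -> theta t = shear_gain t.
Proof.
move=> t0; have r0 := shear_gain_gt0 t; have rt := shear_gainBV t.
have ubr : ubound [set enorm (mx22 1 t 0 1 *m x) | x in [set x | enorm x <= 1]]
    (shear_gain t).
  move=> _ [x /= x1 <-]; rewrite enorm_le ?(ltW r0)// !mulmx_ord2 !mxE/=.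
  rewrite !mul1r mul0r add0r (le_trans (shear_sqnorm _ _ t0))//.
  rewrite ler_piMr ?sqr_ge0//.
  by move: x1; rewrite enorm_le// expr1n.
apply/eqP; rewrite eq_le; apply/andP; split.
  apply: ge_sup => //; exists (enorm (mx22 1 t 0 1 *m 0)), 0 => //=.
  by rewrite enorm_le// !mxE expr0n/= addr0 expr1n.
move: r0 rt ubr; move: (shear_gain t) => r r0 rt ubr.
apply: ub_le_sup; first by exists r.
pose n := Num.sqrt (1 + r ^+ 2).
have n2 : n ^+ 2 = 1 + r ^+ 2 by rewrite sqr_sqrtr// addr_ge0 ?sqr_ge0.
have n0 : 0 < n by rewrite sqrtr_gt0 ltr_wpDr ?sqr_ge0.
exists (\col_i (if i == 0 then n^-1 else r / n)) => /=.
  rewrite enorm_le// !mxE/= -subr_ge0 expr1n.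
  have -> : 1 - (n^-1 ^+ 2 + (r / n) ^+ 2) = (n ^+ 2 - (1 + r ^+ 2)) / n ^+ 2.
    by field; rewrite gt_eqF.
  by rewrite n2 subrr mul0r.
apply: (@pexpIrn R 2) => //; rewrite ?nnegrE ?enorm_ge0 ?ltW//.
rewrite enorm_sqr !mulmx_ord2 !mxE/= -rt.
have -> : (1 * n^-1 + (r - r^-1) * (r / n)) ^+ 2 + (0 * n^-1 + 1 * (r / n)) ^+ 2
  = r ^+ 2 * ((1 + r ^+ 2) / n ^+ 2).
  by field; rewrite !gt_eqF.
by rewrite n2 divff ?mulr1// -n2 gt_eqF// exprn_gt0.
Qed.

Lemma ln_theta t : 0 <= t -> ln (theta t) = arsinh (t / 2).
Proof. by move=> t0; rewrite theta_shear_gain// /shear_gain expRK. Qed.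

End arsinh_theory.

(** * Growth and decay rates of the two modes, and the equation for tau *)

Section rates.
Variable R : realType.
Implicit Types n k q s t tau : R.

(** The logarithmic contraction guaranteed by a stay of length t in the mode with
    eigenvalue - n, when the off-diagonal entry is 2 k in absolute value. *)
Definition decay n k t : R := n * t - arsinh (k * t).

(** The logarithmic growth allowed by a stay of length s in the mode with
    eigenvalue n and off-diagonal entry 1. *)
Definition growth n s : R := n * s + arsinh (s / 2).

Lemma tau_equationE (n1 n2 eta q t : R) : 0 <= eta ->
  tau_equation n1 n2 eta q t <-> growth n2 eta = decay n1 (q ^+ 2 / 2) t.
Proof. by move=> eta0; rewrite /tau_equation ln_theta. Qed.

Lemma growth_lt n : 0 <= n -> {homo growth n : s t / s < t}.
Proof.
move=> n0 s t st; rewrite /growth ler_ltD//; first by rewrite ler_wpM2l// ltW.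
by rewrite arsinh_lt ltr_pM2r.
Qed.

Lemma growth_le n : 0 <= n -> {homo growth n : s t / s <= t}.
Proof. by move=> n0; apply/ltW_homo/growth_lt. Qed.

Lemma growth_gt0 n s : 0 <= n -> 0 < s -> 0 < growth n s.
Proof.
by move=> n0 /(growth_lt n0); rewrite {1}/growth mulr0 mul0r arsinh0 addr0.
Qed.

(** The linear part is homogeneous and arsinh is subhomogeneous for factors
    at least 1. *)
Lemma decay_scale n k tau t : 0 <= k -> 0 < tau -> tau <= t ->
  t / tau * decay n k tau <= decay n k t.
Proof.
move=> k0 tau0 taut; have tt : 1 <= t / tau by rewrite ler_pdivlMr ?mul1r.
have := arsinh_scale tt (mulr_ge0 k0 (ltW tau0)).
have -> : t / tau * (k * tau) = k * t by field; rewrite gt_eqF.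
rewrite /decay mulrBr (_ : t / tau * (n * tau) = n * t) ?lerD2l ?lerN2//.
by field; rewrite gt_eqF.
Qed.

(** The decay rate may be negative at first; once it is positive, [decay_scale]
    makes it increase forever. *)
Lemma decay_lt n k tau t : 0 <= k -> 0 < tau -> 0 < decay n k tau -> tau < t ->
  decay n k tau < decay n k t.
Proof.
move=> k0 tau0 g0 taut; apply: lt_le_trans (decay_scale _ k0 tau0 (ltW taut)).
by rewrite ltr_pMl// ltr_pdivlMr ?mul1r.
Qed.

Lemma decay_le n k tau t : 0 <= k -> 0 < tau -> 0 < decay n k tau -> tau <= t ->
  decay n k tau <= decay n k t.
Proof.
move=> k0 tau0 g0; rewrite le_eqVlt => /predU1P[->//|taut].
exact/ltW/decay_lt.
Qed.

(** A bound for interrupted stays, during which the norm may grow: beyond tau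
    the decay is positive, and before tau only the arsinh term counts. *)
Lemma decay_ge n k tau t : 0 <= n -> 0 <= k -> 0 < tau -> 0 < decay n k tau -> 0 <= t ->
  - arsinh (k * tau) <= decay n k t.
Proof.
move=> n0 k0 tau0 g0 t0; have [taut|ttau] := leP tau t.
  apply: le_trans (decay_le k0 tau0 g0 taut).
  by rewrite /decay lerDr mulr_ge0// ltW.
rewrite /decay -[leLHS]add0r lerD ?mulr_ge0// lerN2 arsinh_le.
by rewrite ler_wpM2l// ltW.
Qed.

(** Writing n T = z + H, the claim becomes (k / n) (z + H) <= sinh z, and
    exp z >= (1 + z / 2) ^ 2 makes sinh z >= z / 2 + z ^ 2 / 8. *)
Lemma decay_unbounded n k (H : R) : 0 < n -> 0 <= k -> 0 < H ->
  exists2 T, 0 < T & H <= decay n k T.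
Proof.
move=> n0 k0 H0; have : 0 <= k / n by rewrite divr_ge0// ltW.
move CE : (k / n) => C C0.
(* The term 8 C makes z ^ 2 / 8 >= C z, and 2 C H makes z / 2 >= C H. *)
pose z := 8 * C + 2 * C * H; have z0 : 0 <= z.
  apply: addr_ge0; first exact: mulr_ge0.
  by rewrite !mulr_ge0// ltW.
exists ((z + H) / n); first by rewrite divr_gt0// ltr_wpDl.
rewrite /decay mulrC divfK ?gt_eqF// addrAC -subr_ge0 addrK subr_ge0.
rewrite -[leRHS](@sinhK R) arsinh_le.
have -> : k * ((z + H) / n) = C * (z + H) by rewrite -CE; field; rewrite gt_eqF.
have e1 : expR z = expR (z / 2) ^+ 2.
  by rewrite expr2 -expRD; congr expR; field.
have e2 : (1 + z / 2) ^+ 2 <= expR z.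
  have zh : 0 <= 1 + z / 2 by rewrite addr_ge0// divr_ge0.
  by rewrite e1 lerXn2r ?nnegrE ?expR_ge0 ?expR_ge1Dx.
have e3 : expR (- z) <= 1 by rewrite -expR0 ler_expR oppr_le0.
rewrite /sinh.
have h1 : C * (z + H) <= z / 2 + z ^+ 2 / 8.
  have -> : z / 2 + z ^+ 2 / 8 = C * (z + H) + 4 * C + C * H * z / 4.
    by rewrite /z; field.
  have CHz : 0 <= C * H * z / 4 by rewrite divr_ge0// !mulr_ge0// ltW.
  by rewrite -[leRHS]addrA lerDl addr_ge0// mulr_ge0.
apply: le_trans h1 _.
set ez := expR z in e2 *; set emz := expR (- z) in e3 *.
have : z / 2 + z ^+ 2 / 8 = ((1 + z / 2) ^+ 2 - 1) / 2 by field.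
move: (_ ^+ 2) (_ + _) e2 => X Y e2; lra.
Qed.

Lemma continuous_decay n k : continuous (decay n k).
Proof.
move=> t; rewrite /decay; apply: cvgB; first exact: mulrl_continuous.
by apply: continuous_comp; [exact: mulrl_continuous|exact: continuous_arsinh].
Qed.

Lemma decay_solution n k (H : R) : 0 < n -> 0 <= k -> 0 < H ->
  exists! tau, 0 < tau /\ H = decay n k tau.
Proof.
move=> n0 k0 H0.
have [T T0 HT] := decay_unbounded n0 k0 H0.
have g0 : decay n k 0 = 0 by rewrite /decay !mulr0 arsinh0 subr0.
have [|c] := @IVT _ (decay n k) 0 T H (ltW T0) (continuous_subspaceT (@continuous_decay n k)).
  by rewrite g0 ge_min le_max HT ltW//= orbT.
rewrite in_itv/= => /andP[c0 _] Hc.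
have {}c0 : 0 < c.
  rewrite lt_neqAle c0 andbT; apply/eqP => c00.
  by move: H0; rewrite -Hc -c00 g0 ltxx.
exists c; split=> //.
have uniq u v : 0 < u -> H = decay n k u -> H = decay n k v -> ~ u < v.
  move=> u0 Hu Hv uv; have := @decay_lt n k u v k0 u0.
  by rewrite -Hu -Hv ltxx => /(_ H0 uv).
move=> v [v0 Hv]; case: (ltgtP c v) => // cv.
- by case: (uniq c v).
- by case: (uniq v c).
Qed.

End rates.

(** * The flow of a planar Jordan block *)

Section jordan_flow.
Variable R : realType.
Implicit Types l k d e t : R.

Lemma derive0_const (z : R -> R) d e : d <= e ->
  {within `[d, e], continuous z} ->
  (forall t, t \in `]d, e[ -> is_derive t 1 z 0) -> z e = z d.
Proof.
move=> de zc zd; apply/eqP; rewrite -subr_eq0; apply/eqP.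
by have [c _ ->] := @MVT_segment _ z (fun=> 0) d e de zd zc; rewrite mul0r.
Qed.

(** Undoing the expected flow, that is multiplying (y1, y2) by exp (- l (t - d))
    and by the inverse shear, gives two functions with zero derivative. *)
Lemma jordan_flow l k d e (y1 y2 : R -> R) : d <= e ->
  {within `[d, e], continuous y1} -> {within `[d, e], continuous y2} ->
  (forall t, t \in `]d, e[ ->
     is_derive t 1 y1 (l * y1 t + k * y2 t) /\ is_derive t 1 y2 (l * y2 t)) ->
  y1 e = expR (l * (e - d)) * (y1 d + k * (e - d) * y2 d) /\
  y2 e = expR (l * (e - d)) * y2 d.
Proof.
move=> de c1 c2 dy.
pose E t : R := expR (- l * (t - d)).
pose D t : R := k * (t - d).
have Ed : E d = 1 by rewrite /E subrr mulr0 expR0.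
have dE t : is_derive t 1 E (- l * E t).
  by apply: is_derive_eq; rewrite /E /GRing.scale/=; ring.
have dD t : is_derive t 1 D k.
  by rewrite /D; apply: is_derive_eq; rewrite /GRing.scale/=; ring.
have cE : {within `[d, e], continuous E}.
  apply: continuous_subspaceT => u; apply: differentiable_continuous.
  by apply/derivable1_diffP; have [] := dE u.
have cD : {within `[d, e], continuous D}.
  apply: continuous_subspaceT => u; apply: differentiable_continuous.
  by apply/derivable1_diffP; have [] := dD u.
have z2 : E e * y2 e = y2 d.
  rewrite -[RHS]mul1r -Ed; pose z t := E t * y2 t.
  suff : z e = z d by [].
  apply: (derive0_const de).
    by move=> u; apply: cvgM; [exact: cE|exact: c2].
  move=> t /dy[_ h2]; have h0 := dE t.
  by apply: is_derive_eq; rewrite /GRing.scale/=; ring.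
have z1 : E e * (y1 e - D e * y2 e) = y1 d.
  transitivity (E d * (y1 d - D d * y2 d)); last first.
    by rewrite Ed /D subrr mulr0 mul0r subr0 mul1r.
  pose z t := E t * (y1 t - D t * y2 t).
  suff : z e = z d by [].
  apply: (derive0_const de).
    move=> u; apply: cvgM; first exact: cE.
    apply: cvgB; first exact: c1.
    by apply: cvgM; [exact: cD|exact: c2].
  move=> t /dy[h1 h2]; have h0 := dE t; have h3 := dD t.
  by apply: is_derive_eq; rewrite /GRing.scale/=; ring.
have EV : expR (l * (e - d)) * E e = 1.
  by rewrite /E -expRD mulNr subrr expR0.
split; last by rewrite -z2 mulrA EV mul1r.
rewrite -z1 -z2 -/(D e).
transitivity ((expR (l * (e - d)) * E e) * y1 e); first by rewrite EV mul1r.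
ring.
Qed.

Lemma jordan_growth l k d e (y1 y2 : R -> R) : d <= e ->
  {within `[d, e], continuous y1} -> {within `[d, e], continuous y2} ->
  (forall t, t \in `]d, e[ ->
     is_derive t 1 y1 (l * y1 t + k * y2 t) /\ is_derive t 1 y2 (l * y2 t)) ->
  y1 e ^+ 2 + y2 e ^+ 2 <=
    expR (l * (e - d) + arsinh (`|k| / 2 * (e - d))) ^+ 2 * (y1 d ^+ 2 + y2 d ^+ 2).
Proof.
move=> de c1 c2 dy; have [-> ->] := jordan_flow de c1 c2 dy.
rewrite !exprMn -mulrDr expRD exprMn -[leRHS]mulrA ler_wpM2l ?sqr_ge0//.
have -> : `|k| / 2 * (e - d) = `|k * (e - d)| / 2.
  by rewrite normrM (@ger0_norm _ (e - d)) ?subr_ge0// mulrAC.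
exact: shear_sqnorm_abs.
Qed.

End jordan_flow.

(** * Coordinates adapted to both modes *)

Section linear_change.
Variable R : realType.
Implicit Types A B Q : 'M[R]_2.

Lemma is_derive_coord (x : R -> 'cV[R]_2) (v : 'cV[R]_2) (t : R) i :
  is_derive t 1 x v -> is_derive t 1 (fun u => x u i 0) (v i 0).
Proof.
move=> [dx <-]; have /derivable_mxP dx' := dx.
by split; [exact: dx'|rewrite derive_mx// mxE].
Qed.

Lemma is_derive_mulmx A (x : R -> 'cV[R]_2) (v : 'cV[R]_2) (t : R) i :
  is_derive t 1 x v -> is_derive t 1 (fun u => (A *m x u) i 0) ((A *m v) i 0).
Proof.
move=> dx; under eq_fun do rewrite mulmx_ord2; rewrite mulmx_ord2.
have d0 := is_derive_coord 0 dx; have d1 := is_derive_coord 1 dx.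
exact: is_deriveD.
Qed.

Lemma within_continuous_mulmx A (D : set R) (x : R -> 'cV[R]_2) i :
  {within D, continuous x} -> {within D, continuous (fun u => (A *m x u) i 0)}.
Proof.
move=> cx; under eq_fun do rewrite mulmx_ord2.
have cxi j : {within D, continuous (fun u => x u j 0)}.
  move=> u.
  exact: (@cvg_comp _ _ _ x (fun M : 'cV[R]_2 => M j 0) _ _ _
    (cx u) (@coord_continuous _ 2 1 j 0 _)).
by move=> u; apply: cvgD; apply: cvgM; first [exact: cvg_cst|exact: cxi].
Qed.

Lemma enorm_mulmx_bound A :
  exists2 C : R, 0 < C & forall x : 'cV[R]_2, enorm (A *m x) <= C * enorm x.
Proof.
pose S := A 0 0 ^+ 2 + A 0 1 ^+ 2 + (A 1 0 ^+ 2 + A 1 1 ^+ 2).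
have S0 : 0 <= S by rewrite !addr_ge0 ?sqr_ge0.
exists (1 + Num.sqrt S); first by rewrite ltr_wpDr ?sqrtr_ge0.
move=> x; have sx0 : 0 <= Num.sqrt S * enorm x by rewrite mulr_ge0 ?sqrtr_ge0 ?enorm_ge0.
apply: (@le_trans _ _ (Num.sqrt S * enorm x)); last first.
  by rewrite mulrDl mul1r lerDr enorm_ge0.
rewrite enorm_le// exprMn sqr_sqrtr// enorm_sqr !mulmx_ord2 -subr_ge0.
have -> : S * (x 0 0 ^+ 2 + x 1 0 ^+ 2) -
    ((A 0 0 * x 0 0 + A 0 1 * x 1 0) ^+ 2 + (A 1 0 * x 0 0 + A 1 1 * x 1 0) ^+ 2) =
  (A 0 0 * x 1 0 - A 0 1 * x 0 0) ^+ 2 + (A 1 0 * x 1 0 - A 1 1 * x 0 0) ^+ 2.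
  by rewrite /S; ring.
by rewrite addr_ge0 ?sqr_ge0.
Qed.

(** The two shapes of the matrix differ by the order of the coordinates, which
    the Euclidean norm does not see. *)
Lemma flow_growth A Q (l k d e : R) (x : R -> 'cV[R]_2) : d <= e ->
  Q *m A = mx22 l k 0 l *m Q \/ Q *m A = mx22 l 0 k l *m Q ->
  {within `[d, e], continuous x} ->
  (forall t, t \in `]d, e[ -> is_derive t 1 x (A *m x t)) ->
  enorm (Q *m x e) <=
    expR (l * (e - d) + arsinh (`|k| / 2 * (e - d))) * enorm (Q *m x d).
Proof.
move=> de QA cx dx.
have cy i := @within_continuous_mulmx Q _ x i cx.
have dy i t : t \in `]d, e[ -> is_derive t 1 (fun u => (Q *m x u) i 0) ((Q *m (A *m x t)) i 0).
  by move=> /dx; exact: is_derive_mulmx.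
rewrite enorm_le ?mulr_ge0 ?expR_ge0 ?enorm_ge0// exprMn enorm_sqr.
case: QA => QA.
- apply: (jordan_growth de (cy 0) (cy 1)) => t tde.
  have := dy 0 t tde; have := dy 1 t tde.
  rewrite mulmxA QA -mulmxA mulmx_ord2 (mulmx_ord2 _ _ 0) !mxE/=.
  by rewrite mul0r add0r.
- rewrite addrC (addrC ((Q *m x d) 0 0 ^+ 2)).
  apply: (jordan_growth de (cy 1) (cy 0)) => t tde.
  have := dy 0 t tde; have := dy 1 t tde.
  rewrite mulmxA QA -mulmxA mulmx_ord2 (mulmx_ord2 _ _ 0) !mxE/=.
  by rewrite mul0r addr0 addrC.
Qed.

Lemma mx22E A : A = mx22 (A 0 0) (A 0 1) (A 1 0) (A 1 1).
Proof.
apply/matrixP => i j; rewrite mxE.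
case: (unliftP 0 i) => [i'|]; case: (unliftP 0 j) => [j'|] -> -> //=;
  congr (A _ _); apply/val_inj; rewrite /= ?ord1//.
Qed.

Lemma mx22_mul (a b c d a' b' c' d' : R) :
  mx22 a b c d *m mx22 a' b' c' d' =
  mx22 (a * a' + b * c') (a * b' + b * d') (c * a' + d * c') (c * b' + d * d').
Proof.
apply/matrixP => i j; rewrite !mxE sum_ord2 !mxE/=.
by case: (i == 0); case: (j == 0).
Qed.

Lemma det_mx22 (a b c d : R) : \det (mx22 a b c d) = a * d - b * c.
Proof.
rewrite (expand_det_row _ 0) sum_ord2 /cofactor !det_mx11 !mxE/=.
by rewrite /bump/=; ring.
Qed.

(** Q is (P2 U)^-1 with U upper unitriangular: U = 1 if c = 0, and otherwise U
    has corner a / c, which kills the upper left entry of U^-1 P2^-1 P1. Then A1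
    becomes its Jordan block conjugated by a triangular or antitriangular matrix
    of determinant 1 up to sign. Intertwining relations are used
    instead of conjugations, so that no inverse of P2^-1 P1 is computed. *)
Lemma common_coordinates (n1 n2 a b c d : R) (A1 A2 P1 P2 : 'M[R]_2) :
  P1 \in unitmx -> P2 \in unitmx -> `|\det P1| = 1 -> `|\det P2| = 1 ->
  A1 = P1 *m jordan2 (- n1) *m invmx P1 ->
  A2 = P2 *m jordan2 n2 *m invmx P2 ->
  invmx P2 *m P1 = mx22 a b c d ->
  exists (Q Q' : 'M[R]_2) (k : R), [/\ Q' *m Q = 1%:M,
    `|k| = (if c == 0 then a else c) ^+ 2,
    Q *m A1 = mx22 (- n1) k 0 (- n1) *m Q \/
    Q *m A1 = mx22 (- n1) 0 k (- n1) *m Q &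
    Q *m A2 = jordan2 n2 *m Q].
Proof.
move=> uP1 uP2 dP1 dP2 -> -> HM.
have detM : `|a * d - b * c| = 1.
  by rewrite -det_mx22 -HM det_mulmx det_inv normrM normfV dP1 dP2 invr1 mulr1.
(* K is the matrix of A1 in the coordinates T (P2^-1 x), provided that K is
   conjugate to the Jordan block of A1 by T P2^-1 P1. *)
have intertwine (T K : 'M[R]_2) :
    K *m (T *m mx22 a b c d) = T *m mx22 a b c d *m jordan2 (- n1) ->
    T *m invmx P2 *m (P1 *m jordan2 (- n1) *m invmx P1) = K *m (T *m invmx P2).
  move=> KT; transitivity (K *m (T *m mx22 a b c d) *m invmx P1).
    by rewrite KT -HM !mulmxA.
  by rewrite -HM -!mulmxA mulmxV// mulmx1.
have [c0|c0] := eqVneq c 0.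
- have ad : `|a * d| = 1 by rewrite -detM c0 mulr0 subr0.
  have d0 : d != 0 by apply: contra_eq_neq ad => ->; rewrite mulr0 normr0 eq_sym oner_eq0.
  have q : `|a / d| = a ^+ 2.
    have -> : a / d = a ^+ 2 / (a * d).
      field; rewrite d0 /=; apply: contra_eq_neq ad => ->.
      by rewrite mul0r normr0 eq_sym oner_eq0.
    by rewrite normrM normfV ad invr1 mulr1 ger0_norm ?sqr_ge0.
  exists (1%:M *m invmx P2), P2, (a / d); split => //.
  + by rewrite mul1mx mulmxV.
  + left; apply: intertwine; rewrite mul1mx c0 /jordan2 !mx22_mul.
    by congr mx22; field.
  + by rewrite mul1mx !mulmxA mulVmx// mul1mx.
- pose u := a / c; pose b' := b - u * d.
  have b'c : b' * c = - (a * d - b * c) by rewrite /b' /u; field.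
  have b'0 : b' != 0.
    apply: contra_eq_neq detM => b'0.
    by rewrite -normrN -b'c b'0 mul0r normr0 eq_sym oner_eq0.
  exists (mx22 1 (- u) 0 1 *m invmx P2), (P2 *m mx22 1 u 0 1), (c / b'); split.
  + rewrite -mulmxA (mulmxA (mx22 1 u 0 1)) mx22_mul.
    rewrite (_ : mx22 _ _ _ _ = 1%:M) ?mul1mx ?mulmxV//.
    by rewrite [RHS]mx22E !mxE/=; congr mx22; ring.
  + have -> : c / b' = c ^+ 2 / (b' * c) by field; rewrite b'0 c0.
    by rewrite b'c normrM normfV normrN detM invr1 mulr1 ger0_norm ?sqr_ge0.
  + right; apply: intertwine; rewrite /jordan2 !mx22_mul.
    have b'E : b = b' + u * d by rewrite /b' subrK.
    have aE : a = u * c by rewrite /u divfK.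
    by rewrite b'E aE; congr mx22; field.
  + rewrite !mulmxA -(mulmxA _ (invmx P2)) mulVmx// mulmx1 /jordan2 !mx22_mul.
    by congr (_ *m _); congr mx22; ring.
Qed.

End linear_change.

(** * A nonnegative quantity controlled along the periods of a signal *)

Section dwell_flee_decay.
Variables (R : realType) (n1 n2 kap tau eta : R) (s : switching_signal R).
Variable V : R -> R.
Hypotheses (hn1 : 0 <= n1) (hn2 : 0 <= n2) (hkap : 0 <= kap).
Hypotheses (htau : 0 < tau) (heta : 0 < eta).
Hypothesis balance : growth n2 eta = decay n1 kap tau.
Hypothesis sS : dwell_flee tau eta s.
Hypothesis V_ge0 : forall t, 0 <= V t.
Hypothesis V_mode1 : forall k t, disc s k.*2 <= t <= disc s k.*2.+1 ->
  V t <= expR (- decay n1 kap (t - disc s k.*2)) * V (disc s k.*2).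
Hypothesis V_mode2 : forall k t, disc s k.*2.+1 <= t <= disc s k.*2.+2 ->
  V t <= expR (growth n2 (t - disc s k.*2.+1)) * V (disc s k.*2.+1).

(* W k is the value of V at the start of the period of index k, when the signal
   enters the first mode. *)
Let W k := V (disc s k.*2).

Lemma decay_tau_gt0 : 0 < decay n1 kap tau.
Proof. by rewrite -balance growth_gt0. Qed.

Lemma V_mode2_start k t : disc s k.*2.+1 <= t <= disc s k.*2.+2 ->
  V t <= expR (growth n2 (t - disc s k.*2.+1) - decay n1 kap (time1 s k)) * W k.
Proof.
move=> /V_mode2 /le_trans; apply.
rewrite expRD -mulrA ler_wpM2l ?expR_ge0//.
by apply: V_mode1; rewrite lexx ltW ?disc_lt.
Qed.

Lemma period_contraction k :
  W k.+1 <= expR (growth n2 (time2 s k) - decay n1 kap (time1 s k)) * W k.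
Proof. by apply: V_mode2_start; rewrite doubleS lexx ltW ?disc_lt. Qed.

Lemma period_exponent_le0 k : growth n2 (time2 s k) - decay n1 kap (time1 s k) <= 0.
Proof.
have [_ /(_ k)[tk sk]] := sS.
rewrite subr_le0 (le_trans (growth_le hn2 sk))// balance.
exact: decay_le decay_tau_gt0 tk.
Qed.

Lemma period_nonincreasing : {homo W : k m / (k <= m)%N >-> m <= k}.
Proof.
apply: homo_leq => //=; first by move=> x y z xy /le_trans; apply.
move=> k; apply: le_trans (period_contraction k) _.
by rewrite ler_piMl ?V_ge0// -expR0 ler_expR period_exponent_le0.
Qed.

(** In the first mode the decay is at least - arsinh (kap tau); in the second
    one the decay gained in the first mode already outweighs the growth. *)
Lemma period_overshoot k t : disc s k.*2 <= t <= disc s k.*2.+2 ->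
  V t <= expR (arsinh (kap * tau)) * W k.
Proof.
move=> /andP[kt tk]; have g0 := decay_tau_gt0.
have [t1|t1] := leP t (disc s k.*2.+1).
  apply: le_trans (@V_mode1 k t _) _; first by rewrite kt.
  rewrite ler_wpM2r ?V_ge0// ler_expR lerNl.
  by rewrite (decay_ge hn1 hkap htau g0)// subr_ge0.
apply: le_trans (@V_mode2_start k t _) _; first by rewrite (ltW t1).
rewrite ler_wpM2r ?V_ge0// ler_expR.
apply: (@le_trans _ _ 0); last by rewrite arsinh_ge0// mulr_ge0// ltW.
apply: le_trans (period_exponent_le0 k); rewrite lerD2r growth_le//.
by rewrite /time2 lerD2r.
Qed.

Lemma period_exists t : 0 <= t ->
  exists k, disc s k.*2 <= t <= disc s k.*2.+2.
Proof.
move=> t0; have [N _ HN] := (cvgryPge (disc s)).1 (@disc_cvgy _ s) (t + 1).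
have ex : exists n, t < disc s n.*2.
  exists N; apply: (@lt_le_trans _ _ (t + 1)); first by rewrite ltrDl.
  by apply: HN => /=; rewrite -addnn leq_addr.
case: (ex_minnP ex) => -[|k].
  by rewrite double0 disc0 ltNge t0.
move=> tk kmin; exists k; rewrite -doubleS (ltW tk) andbT leNgt.
by apply/negP => /kmin; rewrite ltnn.
Qed.

Lemma dwell_flee_bounded t : 0 <= t -> V t <= expR (arsinh (kap * tau)) * V 0.
Proof.
move=> /period_exists[k /period_overshoot /le_trans]; apply.
rewrite ler_wpM2l ?expR_ge0//.
by have := period_nonincreasing (leq0n k); rewrite /W double0 disc0.
Qed.

(** Because t_k >= tau and s_k <= eta, the distance to the limits is one-sided. *)
Lemma not_cvg_frequently_far : dwell_flee' tau eta s ->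
  exists2 e : R, 0 < e & forall N, exists2 k, (N <= k)%N &
    tau + e <= time1 s k \/ time2 s k <= eta - e.
Proof.
move=> [_ ncvg]; apply: contrapT => far; apply: ncvg.
have near e : 0 < e -> \forall k \near \oo,
    time1 s k < tau + e /\ eta - e < time2 s k.
  move=> e0; apply: contrapT => nn; apply: far; exists e => // N.
  apply: contrapT => nk; apply: nn; exists N => // k /= Nk.
  by split; rewrite ltNge; apply/negP => h; apply: nk; exists k => //; [left|right].
have [_ sk] := sS.
apply: (@cvg_pair _ _ _ _ (nbhs tau) (nbhs eta)).
- apply/cvgrPdist_lt => e /near; apply: filterS => k [t1 _].
  by have [t2 _] := sk k; rewrite distrC ger0_norm ?subr_ge0// ltrBlDl.
- apply/cvgrPdist_lt => e /near; apply: filterS => k [_ s1].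
  by have [_ s2] := sk k; rewrite ger0_norm ?subr_ge0// ltrBlDr -ltrBlDl.
Qed.

Lemma frequent_contraction : dwell_flee' tau eta s ->
  exists2 r : R, 0 < r < 1 & forall N, exists2 k, (N <= k)%N & W k.+1 <= r * W k.
Proof.
move=> /not_cvg_frequently_far[e e0 far]; have g0 := decay_tau_gt0.
pose z := Num.max (growth n2 eta - decay n1 kap (tau + e))
                  (growth n2 (eta - e) - decay n1 kap tau).
exists (expR z).
  rewrite expR_gt0 -expR0 ltr_expR gt_max !subr_lt0 balance -{2}balance.
  by rewrite decay_lt ?growth_lt ?ltrDl ?ltrBlDr ?ltrDl.
move=> N; have [k Nk kfar] := far N; exists k => //.
apply: le_trans (period_contraction k) _.
rewrite ler_wpM2r ?V_ge0// ler_expR le_max.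
have [_ /(_ k)[tk sk]] := sS.
case: kfar => h; apply/orP; [left|right]; apply: lerB; rewrite ?growth_le//.
- have te : tau <= tau + e by rewrite lerDl ltW.
  apply: decay_le h => //; first by rewrite (lt_le_trans htau).
  exact: lt_le_trans g0 (decay_le hkap htau g0 te).
- exact: decay_le g0 tk.
Qed.

(** The values at the starts of the periods do not increase and are infinitely
    often multiplied by at most r < 1, so they fall below r ^ n W_0 for every n;
    the overshoot bound extends this to the times in between. *)
Lemma dwell_flee_cvg0 : dwell_flee' tau eta s -> V t @[t --> +oo] --> 0.
Proof.
move=> /frequent_contraction[r /andP[r0 r1] rW].
pose B := expR (arsinh (kap * tau)).
have geo n : exists k, W k <= r ^+ n * W 0%N.
  elim: n => [|n [k IH]]; first by exists 0%N; rewrite expr0 mul1r.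
  have [m km Wm] := rW k; exists m.+1; rewrite exprS -mulrA.
  apply: le_trans Wm _; rewrite ler_wpM2l ?(ltW r0)//.
  exact: le_trans (period_nonincreasing km) IH.
apply/cvgr0Pnorm_lt => e e0.
have : (r ^+ n * (B * W 0%N)) @[n --> \oo] --> 0.
  rewrite -(mul0r (B * W 0%N)); apply: cvgMl; apply: cvg_expr.
  by rewrite ger0_norm ?ltW.
move/cvgr0Pnorm_lt => /(_ e e0)[N _ /(_ N (leqnn N))/= HN].
have [k Wk] := geo N.
exists (disc s k.*2); split; first exact: num_real.
move=> t kt; rewrite ger0_norm ?V_ge0//; apply: le_lt_trans HN.
apply: le_trans (ler_norm _).
have d0 : 0 <= disc s k.*2.
  by elim: (k.*2) => [|m IH]; rewrite ?disc0// (le_trans IH)// ltW ?disc_lt.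
have [m /andP[mt tm]] := period_exists (le_trans d0 (ltW kt)).
have disc_mono : {homo disc s : i j / (i < j)%N >-> i < j}.
  by apply: homo_ltn => [x y z|i]; [exact: lt_trans|exact: disc_lt].
have km : (k <= m)%N.
  rewrite leqNgt; apply/negP => mk.
  have : disc s m.*2.+2 <= disc s k.*2.
    by apply: (ltW_homo disc_mono); rewrite -doubleS leEnat leq_double.
  by rewrite leNgt (lt_le_trans kt).
apply: le_trans (@period_overshoot m t _) _; first by rewrite mt.
rewrite mulrCA ler_wpM2l ?expR_ge0//.
exact: le_trans (period_nonincreasing km) Wk.
Qed.

End dwell_flee_decay.

(** * Trajectories of the switched system *)

Section switched_trajectories.
Variables (R : realType) (n1 n2 kap tau eta k : R) (A1 A2 Q Q' : 'M[R]_2).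
Variable s : switching_signal R.
Hypotheses (hn1 : 0 < n1) (hn2 : 0 <= n2) (htau : 0 < tau) (heta : 0 < eta).
Hypothesis balance : growth n2 eta = decay n1 kap tau.
Hypothesis sS : dwell_flee tau eta s.
Hypothesis Q'Q : Q' *m Q = 1%:M.
Hypothesis k_kap : `|k| / 2 = kap.
Hypothesis QA1 : Q *m A1 = mx22 (- n1) k 0 (- n1) *m Q \/
                 Q *m A1 = mx22 (- n1) 0 k (- n1) *m Q.
Hypothesis QA2 : Q *m A2 = jordan2 n2 *m Q.

Lemma disc_ge0 i : 0 <= disc s i.
Proof. by elim: i => [|i IH]; rewrite ?disc0// (le_trans IH)// ltW ?disc_lt. Qed.

Lemma mode_disc i :
  s (disc s i.*2) = mode1 /\ s (disc s i.*2.+1) = mode2.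
Proof.
have flip j : s (disc s j) = mode1 -> s (disc s j.+1) = mode2.
  by have := @mode_jump _ s j; case: (s (disc s j.+1)) => // + e; rewrite e.
have flop j : s (disc s j) = mode2 -> s (disc s j.+1) = mode1.
  by have := @mode_jump _ s j; case: (s (disc s j.+1)) => // + e; rewrite e.
elim: i => [|i [_ IH]]; last by rewrite doubleS; split; [|apply: flip]; exact: flop.
by have [s0 _] := sS; split; last apply: flip; rewrite double0 disc0.
Qed.

(** A trajectory is only assumed continuous at the switching times, so the
    differential equation is available on the open interval and continuity on
    the closed one, as [flow_growth] requires. *)
Lemma trajectory_on_piece (x : R -> 'cV[R]_2) i (d e : R) :
  trajectory A1 A2 s x -> disc s i <= d -> e <= disc s i.+1 ->
  {within `[d, e], continuous x} /\
  forall t, t \in `]d, e[ -> is_derive t 1 x (mode_mx A1 A2 (s (disc s i)) *m x t).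
Proof.
move=> [cx dx] id ei; split.
  apply: continuous_subspaceW cx => t /=; rewrite !in_itv/= andbT => /andP[dt _].
  exact: le_trans (disc_ge0 i) (le_trans id dt).
move=> t; rewrite in_itv/= => /andP[dt te].
have it : disc s i < t by exact: le_lt_trans dt.
have ti : t < disc s i.+1 by exact: lt_le_trans ei.
rewrite -(@mode_const _ s i t) ?ti ?(ltW it)//.
by apply: (dx i); rewrite it.
Qed.

Lemma trajectory_mode1 (x : R -> 'cV[R]_2) : trajectory A1 A2 s x ->
  forall i t, disc s i.*2 <= t <= disc s i.*2.+1 ->
  enorm (Q *m x t) <=
    expR (- decay n1 kap (t - disc s i.*2)) * enorm (Q *m x (disc s i.*2)).
Proof.
move=> tx i t /andP[it ti]; have [cx] := trajectory_on_piece tx (lexx _) ti.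
have [-> _] := mode_disc i; rewrite /= => dx.
have := flow_growth it QA1 cx dx.
by rewrite k_kap /decay opprB mulNr addrC.
Qed.

Lemma trajectory_mode2 (x : R -> 'cV[R]_2) : trajectory A1 A2 s x ->
  forall i t, disc s i.*2.+1 <= t <= disc s i.*2.+2 ->
  enorm (Q *m x t) <=
    expR (growth n2 (t - disc s i.*2.+1)) * enorm (Q *m x (disc s i.*2.+1)).
Proof.
move=> tx i t /andP[it ti]; have [cx] := trajectory_on_piece tx (lexx _) ti.
have [_ ->] := mode_disc i; rewrite /= => dx.
have := flow_growth it (or_introl QA2) cx dx.
by rewrite normr1 /growth mul1r (mulrC 2^-1).
Qed.

Lemma kap_ge0 : 0 <= kap.
Proof. by rewrite -k_kap divr_ge0. Qed.

(** Transfers bounds on the adapted coordinates back to the state. *)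
Lemma enorm_pullback : exists2 C : R, 0 < C & forall y, enorm y <= C * enorm (Q *m y).
Proof.
have [C C0 hC] := enorm_mulmx_bound Q'; exists C => // y.
by have := hC (Q *m y); rewrite mulmxA Q'Q mul1mx.
Qed.

Lemma switched_stable : stable A1 A2 s.
Proof.
move=> eps eps0; have [C C0 hC] := enorm_pullback.
have [D D0 hD] := enorm_mulmx_bound Q.
pose B := expR (arsinh (kap * tau)); have B0 : 0 < B by exact: expR_gt0.
exists (eps / (C * B * D)); first by rewrite divr_gt0// !mulr_gt0.
move=> x tx x0 t t0; apply: le_lt_trans (hC _) _.
have Vt := dwell_flee_bounded (ltW hn1) hn2 kap_ge0 htau heta balance sS
  (fun t => enorm_ge0 (Q *m x t)) (trajectory_mode1 tx) (trajectory_mode2 tx) (ltW t0).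
have := le_trans Vt (ler_wpM2l (ltW B0) (hD (x 0))).
move/(ler_wpM2l (ltW C0))/le_lt_trans; apply.
by rewrite !mulrA mulrC -ltr_pdivlMr// !mulr_gt0.
Qed.

Lemma switched_attractive (x : R -> 'cV[R]_2) : dwell_flee' tau eta s ->
  trajectory A1 A2 s x -> enorm (x t) @[t --> +oo] --> 0.
Proof.
move=> sS' tx; have [C C0 hC] := enorm_pullback.
have V0 := dwell_flee_cvg0 (ltW hn1) hn2 kap_ge0 htau heta balance sS
  (fun t => enorm_ge0 (Q *m x t)) (trajectory_mode1 tx) (trajectory_mode2 tx) sS'.
apply: (@squeeze_cvgr _ _ _ _ (fun=> 0) (fun t => C * enorm (Q *m x t))).
- by apply: nearW => t; rewrite enorm_ge0 hC.
- exact: cvg_cst.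
- by rewrite -(mulr0 C); apply: cvgMr.
Qed.

End switched_trajectories.

(** * The stability theorem *)

Theorem theorem7p2 (R : realType) (n1 n2 : R) (A1 A2 P1 P2 : 'M[R]_2)
    (a b c d eta : R)
    (hn1 : 0 < n1) (hn2 : 0 <= n2)
    (hP1 : P1 \in unitmx) (hP2 : P2 \in unitmx)
    (hdet1 : `|\det P1| = 1) (hdet2 : `|\det P2| = 1)
    (hA1 : A1 = P1 *m jordan2 (- n1) *m invmx P1)
    (hA2 : A2 = P2 *m jordan2 n2 *m invmx P2)
    (hM : invmx P2 *m P1 = mx22 a b c d)
    (heta : 0 < eta) :
  (exists! tau : R, is_tau21 n1 n2 a c eta tau) /\
  (forall tau : R, is_tau21 n1 n2 a c eta tau ->
    (forall s : switching_signal R,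
       dwell_flee tau eta s -> stable A1 A2 s) /\
    (forall s : switching_signal R,
       dwell_flee' tau eta s -> asymptotically_stable A1 A2 s)).
Proof.
have [Q [Q' [k [Q'Q kq QA1 QA2]]]] :=
  common_coordinates hP1 hP2 hdet1 hdet2 hA1 hA2 hM.
move: kq; set q := if c == 0 then a else c => kq.
have q0 : 0 <= q ^+ 2 / 2 by rewrite divr_ge0 ?sqr_ge0.
have tau21E t : is_tau21 n1 n2 a c eta t <->
    0 < t /\ growth n2 eta = decay n1 (q ^+ 2 / 2) t.
  have eqE u := tau_equationE n1 n2 u t (ltW heta).
  rewrite /is_tau21 /q; case: eqVneq => [->|/eqP c0].
    by split=> [[t0 /(_ erefl)/eqE]|[t0 /eqE]].
  by split=> [[t0 _ /(_ c0)/eqE]|[t0 /eqE]].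
have [tau [tauP tauU]] := decay_solution hn1 q0 (growth_gt0 hn2 heta).
split.
  exists tau; split; first exact/tau21E.
  by move=> t /tau21E; exact: tauU.
move=> t /tau21E[t0 tbal].
have kq2 : `|k| / 2 = q ^+ 2 / 2 by rewrite kq.
split=> s sS.
  exact: (switched_stable hn1 hn2 t0 heta tbal sS Q'Q kq2 QA1 QA2).
have [sS0 _] := sS; split.
  exact: (switched_stable hn1 hn2 t0 heta tbal sS0 Q'Q kq2 QA1 QA2).
move=> x; exact: (switched_attractive hn1 hn2 t0 heta tbal sS0 Q'Q kq2 QA1 QA2).
Qed.
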